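(* Let $\Lambda$ be an arbitrary ring and, for a right $\Lambda$-module $A$, let $A^+:=\mathrm{Hom}_{\mathbb{Z}}(A,\mathbb{Q}/\mathbb{Z})$ be its character module (a left $\Lambda$-module). Then for every right $\Lambda$-module $A$, \[\mathfrak{s}(A)^+\simeq\mathfrak{q}(A^+).\]
   Context: Let $\iota:\Lambda\to I$ be the injective envelope of $\Lambda$ as a left $\Lambda$-module. For a right $\Lambda$-module $A$, the injective torsion is $\mathfrak{s}(A):=\ker(1\otimes\iota:A\otimes_\Lambda\Lambda\to A\otimes_\Lambda I)$, a submodule of $A\cong A\otimes_\Lambda\Lambda$. For a left $\Lambda$-module $C$, the cotorsion module is $\mathfrak{q}(C):=\mathrm{coker}\big(\mathrm{Hom}_\Lambda(I,C)\to\mathrm{Hom}_\Lambda(\Lambda,C)\big)$ (precomposition with $\iota$), i.e. homomorphisms $\Lambda\to C$ modulo those factoring through injective left modules; it is a quotient module of $C\cong\mathrm{Hom}_\Lambda(\Lambda,C)$. *)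

(* Defs.v *)
(* This development uses MathComp together with the classical axioms of       *)
(* mathcomp.classical.boolp. Over a ring R, left modules are [lmodType R] and *)
(* right modules are [lmodType R^c]: in a right module, [r *: a] with         *)
(* r : R^c stands for the product usually written a r.                        *)
From HB Require Import structures.
From mathcomp Require Import all_boot all_order all_algebra.
From mathcomp Require Import generic_quotient ring_quotient.
From mathcomp Require Import boolp.
From mathcomp Require Import freeg.

Set Implicit Arguments.
Unset Strict Implicit.
Unset Printing Implicit Defensive.

Import GRing.Theory.
Local Open Scope ring_scope.
Local Open Scope quotient_scope.

Definition rat_int : {pred rat} := fun q => q \is a Num.int.

Lemma rat_int_zmod_closed : zmod_closed rat_int.
Proof. by split=> [|x y]; rewrite !unfold_in; [exact: rpred0 | exact: rpredB]. Qed.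

HB.instance Definition _ :=
  GRing.isZmodClosed.Build rat rat_int rat_int_zmod_closed.

Definition QZ : zmodType := Quotient.quot (rat_int : zmodClosed rat).

Section ModuleQuotient.
Variables (R : pzRingType) (M : lmodType R) (N : submodClosed M).

Definition quotmod_rel : {pred M} := fun x => x \in N.

Lemma quotmod_rel_zmod_closed : zmod_closed quotmod_rel.
Proof.
split=> [|x y xN yN]; first exact: (rpred0 N).
by rewrite -scaleN1r; apply: rpredD => //; apply: rpredZ.
Qed.

HB.instance Definition _ :=
  GRing.isZmodClosed.Build M quotmod_rel quotmod_rel_zmod_closed.

Definition quotmod := Quotient.quot (quotmod_rel : zmodClosed M).

HB.instance Definition _ := GRing.Zmodule.on quotmod.

Definition quotmod_pi (x : M) : quotmod :=
  \pi_(Quotient.quot (quotmod_rel : zmodClosed M)) x.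

Definition quotmod_scale (r : R) (q : quotmod) : quotmod :=
  quotmod_pi (r *: (repr (q : Quotient.quot (quotmod_rel : zmodClosed M)))).

Lemma quotmod_piP x y : (quotmod_pi x = quotmod_pi y) <-> (x - y \in N).
Proof.
rewrite -[_ \in N]/(x - y \in quotmod_rel) Quotient.idealrBE.
by split=> [e|/eqP]; [apply/eqP|].
Qed.

Lemma quotmod_pi_surj q : exists x, q = quotmod_pi x.
Proof. by exists (repr (q : Quotient.quot (quotmod_rel : zmodClosed M))); rewrite /quotmod_pi reprK. Qed.

Lemma quotmod_piD x y : quotmod_pi (x + y) = quotmod_pi x + quotmod_pi y.
Proof. exact: (raddfD (\pi_(Quotient.quot (quotmod_rel : zmodClosed M)))). Qed.

Lemma quotmod_piZ r x : quotmod_pi (r *: x) = quotmod_scale r (quotmod_pi x).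
Proof.
apply/quotmod_piP; rewrite -scalerBr rpredZ //.
by apply/quotmod_piP; rewrite /quotmod_pi reprK.
Qed.

Lemma quotmod_scaleA r s q :
  quotmod_scale r (quotmod_scale s q) = quotmod_scale (r * s) q.
Proof. by have [x ->] := quotmod_pi_surj q; rewrite -!quotmod_piZ scalerA. Qed.

Lemma quotmod_scale1 : left_id 1 quotmod_scale.
Proof. by move=> q; have [x ->] := quotmod_pi_surj q; rewrite -quotmod_piZ scale1r. Qed.

Lemma quotmod_scaleDr : right_distributive quotmod_scale +%R.
Proof.
move=> r p q; have [x ->] := quotmod_pi_surj p; have [y ->] := quotmod_pi_surj q.
by rewrite -quotmod_piD -!quotmod_piZ -quotmod_piD scalerDr.
Qed.

Lemma quotmod_scaleDl q : {morph quotmod_scale^~ q : r s / r + s}.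
Proof.
move=> r s; have [x ->] := quotmod_pi_surj q.
by rewrite -!quotmod_piZ -quotmod_piD scalerDl.
Qed.

HB.instance Definition _ := GRing.Zmodule_isLmodule.Build R quotmod
  quotmod_scaleA quotmod_scale1 quotmod_scaleDr quotmod_scaleDl.

Lemma quotmod_pi_linear : linear quotmod_pi.
Proof. by move=> r x y; rewrite quotmod_piD quotmod_piZ. Qed.

HB.instance Definition _ :=
  GRing.isLinear.Build R M quotmod *:%R quotmod_pi quotmod_pi_linear.

End ModuleQuotient.

Lemma linear_ext (R : pzRingType) (M N : lmodType R) (f g : {linear M -> N}) :
  f =1 g -> f = g.
Proof.
case: f g => [f [[f1] [f2]]] [g [[g1] [g2]]] /= /funext e.
case: _ / e g1 g2 => g1 g2.
by rewrite (Prop_irrelevance f1 g1) (Prop_irrelevance f2 g2).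
Qed.

Lemma additive_ext (U V : zmodType) (f g : {additive U -> V}) :
  f =1 g -> f = g.
Proof.
case: f g => [f [[f1]]] [g [[g1]]] /= /funext e.
by case: _ / e g1 => g1; rewrite (Prop_irrelevance f1 g1).
Qed.

Section Hom.
Variables (R : pzRingType) (M N : lmodType R).

Definition hom := {linear M -> N}.
Identity Coercion linear_of_hom : hom >-> GRing.Linear.type.

HB.instance Definition _ := gen_eqMixin hom.
HB.instance Definition _ := gen_choiceMixin hom.

Definition hom0 : hom := \0.
Definition homD (f g : hom) : hom := f \+ g.
Definition homN (f : hom) : hom := \- f.

Lemma homDA : associative homD.
Proof. by move=> f g h; apply: linear_ext => x; exact: addrA. Qed.
Lemma homDC : commutative homD.
Proof. by move=> f g; apply: linear_ext => x; exact: addrC. Qed.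
Lemma hom0D : left_id hom0 homD.
Proof. by move=> f; apply: linear_ext => x; exact: add0r. Qed.
Lemma homND : left_inverse hom0 homN homD.
Proof. by move=> f; apply: linear_ext => x; exact: addNr. Qed.

HB.instance Definition _ := GRing.isZmodule.Build hom homDA homDC hom0D homND.

End Hom.

Section RightMultiplication.
Variables (R : pzRingType) (r : R).

Definition rmul (x : R^o) : R^o := (x : R) * r.

Lemma rmul_linear : linear rmul.
Proof. by move=> a x y; rewrite /rmul mulrDl -mulrA. Qed.

HB.instance Definition _ := GRing.isLinear.Build R R^o R^o *:%R rmul rmul_linear.

End RightMultiplication.

(* Hom_R(R, C) is a left module through the right R-action on R:              *)
(* (r f)(x) = f(x r).                                                         *)
Section HomRegular.
Variables (R : pzRingType) (C : lmodType R).

Definition homreg_scale (r : R) (f : hom R^o C) : hom R^o C := f \o rmul r.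

Lemma homreg_scaleA r s f :
  homreg_scale r (homreg_scale s f) = homreg_scale (r * s) f.
Proof. by apply: linear_ext => x /=; rewrite /rmul mulrA. Qed.
Lemma homreg_scale1 : left_id 1 homreg_scale.
Proof. by move=> f; apply: linear_ext => x /=; rewrite /rmul mulr1. Qed.
Lemma homreg_scaleDr : right_distributive homreg_scale +%R.
Proof. by move=> r f g; apply: linear_ext. Qed.
Lemma homreg_scaleDl f : {morph homreg_scale^~ f : r s / r + s}.
Proof.
by move=> r s; apply: linear_ext => x; rewrite /= /rmul mulrDr linearD.
Qed.

HB.instance Definition _ := GRing.Zmodule_isLmodule.Build R (hom R^o C)
  homreg_scaleA homreg_scale1 homreg_scaleDr homreg_scaleDl.

End HomRegular.

(* Hom_Z(A, Q/Z), with (r f)(a) = f(a r).                                     *)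
Section Character.
Variables (R : pzRingType) (A : lmodType R^c).

Definition character := {additive A -> QZ}.
Identity Coercion additive_of_character : character >-> Algebra.Additive.type.

HB.instance Definition _ := gen_eqMixin character.
HB.instance Definition _ := gen_choiceMixin character.

Definition char0 : character := \0.
Definition charD (f g : character) : character := f \+ g.
Definition charN (f : character) : character := \- f.

Lemma charDA : associative charD.
Proof. by move=> f g h; apply: additive_ext => x; exact: addrA. Qed.
Lemma charDC : commutative charD.
Proof. by move=> f g; apply: additive_ext => x; exact: addrC. Qed.
Lemma char0D : left_id char0 charD.
Proof. by move=> f; apply: additive_ext => x; exact: add0r. Qed.
Lemma charND : left_inverse char0 charN charD.
Proof. by move=> f; apply: additive_ext => x; exact: addNr. Qed.

HB.instance Definition _ :=
  GRing.isZmodule.Build character charDA charDC char0D charND.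

Definition char_scale (r : R) (f : character) : character :=
  f \o ( *:%R (r : R^c)).

Lemma char_scaleA r s f : char_scale r (char_scale s f) = char_scale (r * s) f.
Proof. by apply: additive_ext => a /=; rewrite scalerA. Qed.
Lemma char_scale1 : left_id 1 char_scale.
Proof. by move=> f; apply: additive_ext => a /=; rewrite scale1r. Qed.
Lemma char_scaleDr : right_distributive char_scale +%R.
Proof. by move=> r f g; apply: additive_ext. Qed.
Lemma char_scaleDl f : {morph char_scale^~ f : r s / r + s}.
Proof.
by move=> r s; apply: additive_ext => a; rewrite /= scalerDl raddfD.
Qed.

HB.instance Definition _ := GRing.Zmodule_isLmodule.Build R character
  char_scaleA char_scale1 char_scaleDr char_scaleDl.

End Character.

(* A (x)_R M: the free abelian group on A * M modulo the bilinearity and      *)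
(* balancing relations.                                                       *)
Section Tensor.
Variables (R : pzRingType) (A : lmodType R^c) (M : lmodType R).

Definition free_tensor : zmodType := {freeg (A * M)%type / int}.
Definition free_tens (a : A) (m : M) : free_tensor :=
  Freeg [:: (1%:Z, (a, m))].

Inductive tensor_relator : free_tensor -> Prop :=
| RelDl a b m :
    tensor_relator (free_tens (a + b) m - (free_tens a m + free_tens b m))
| RelDr a m n :
    tensor_relator (free_tens a (m + n) - (free_tens a m + free_tens a n))
| RelM a (r : R) m :
    tensor_relator (free_tens ((r : R^c) *: a) m - free_tens a (r *: m)).

Definition tensor_rel : {pred free_tensor} := fun t =>
  `[< forall S : {pred free_tensor}, zmod_closed S ->
        (forall u, tensor_relator u -> u \in S) -> t \in S >].

Lemma tensor_rel_zmod_closed : zmod_closed tensor_rel.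
Proof.
split=> [|t u]; first by apply/asboolP => S [].
move=> /asboolP tS /asboolP uS; apply/asboolP => S Sz Srel.
by case: (Sz) => _; apply; [exact: tS | exact: uS].
Qed.

HB.instance Definition _ :=
  GRing.isZmodClosed.Build free_tensor tensor_rel tensor_rel_zmod_closed.

Definition tensor := Quotient.quot (tensor_rel : zmodClosed free_tensor).

HB.instance Definition _ := GRing.Zmodule.on tensor.

Definition tensor_pi (t : free_tensor) : tensor :=
  \pi_(Quotient.quot (tensor_rel : zmodClosed free_tensor)) t.

Definition tens (a : A) (m : M) : tensor := tensor_pi (free_tens a m).

Lemma tensor_pi_zmod_morphism : zmod_morphism tensor_pi.
Proof. exact: raddfB. Qed.

HB.instance Definition _ :=
  GRing.isZmodMorphism.Build free_tensor tensor tensor_pi tensor_pi_zmod_morphism.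

Lemma tensor_piP t u : tensor_pi t = tensor_pi u <-> t - u \in tensor_rel.
Proof. by rewrite Quotient.idealrBE; split=> [e|/eqP]; [apply/eqP|]. Qed.

Lemma tensor_rel_relator u : tensor_relator u -> u \in tensor_rel.
Proof. by move=> uR; apply/asboolP => S _; apply. Qed.

Lemma tensDl a b m : tens (a + b) m = tens a m + tens b m.
Proof.
by rewrite /tens -raddfD; apply/tensor_piP/tensor_rel_relator; constructor.
Qed.

Lemma tensDr a m n : tens a (m + n) = tens a m + tens a n.
Proof.
by rewrite /tens -raddfD; apply/tensor_piP/tensor_rel_relator; constructor.
Qed.

Lemma tensM a (r : R) m : tens ((r : R^c) *: a) m = tens a (r *: m).
Proof. by apply/tensor_piP/tensor_rel_relator; constructor. Qed.

Lemma tensor_ind (P : tensor -> Prop) :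
  (forall a m, P (tens a m)) -> (forall t u, P t -> P u -> P (t - u)) ->
  forall t, P t.
Proof.
move=> Pt PB t.
have -> : t = tensor_pi (repr (t : Quotient.quot (tensor_rel : zmodClosed _))).
  by rewrite /tensor_pi reprK.
have P0 : P 0 by rewrite -(subrr (tens 0 0)); exact: PB.
have PN u : P u -> P (- u) by move=> Pu; rewrite -sub0r; exact: PB.
have PD u v : P u -> P v -> P (u + v).
  by move=> Pu /PN Pv; rewrite -(opprK v); exact: PB.
rewrite -[X in tensor_pi X]freeg_sumE raddf_sum /=.
elim/big_ind: _ => // -[a m] _; rewrite -[coeff _ _]intz -freegU_mulz raddfMz.
have PMn n : P (tens a m *+ n).
  by elim: n => [|n IHn]; rewrite ?mulr0n // mulrS; apply: PD.
by case: (coeff _ _) => n; [exact: PMn | exact: PN (PMn n.+1)].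
Qed.

Lemma tensor_ext (V : zmodType) (f g : {additive tensor -> V}) :
  (forall a m, f (tens a m) = g (tens a m)) -> f =1 g.
Proof.
by move=> fg; elim/tensor_ind => [//|t u]; rewrite !raddfB => -> ->.
Qed.

Section Lift.
Variables (V : zmodType) (f : A -> M -> V).
Hypothesis fDl : forall a b m, f (a + b) m = f a m + f b m.
Hypothesis fDr : forall a m n, f a (m + n) = f a m + f a n.
Hypothesis fM : forall a (r : R) m, f ((r : R^c) *: a) m = f a (r *: m).

Definition free_tensor_lift (t : free_tensor) : V :=
  fglift (fun am : A * M => f am.1 am.2 : zmodule V) t.

Lemma free_tensor_lift_zmod_morphism : zmod_morphism free_tensor_lift.
Proof. exact: (@lift_is_additive int (A * M)%type (zmodule V)). Qed.

HB.instance Definition _ := GRing.isZmodMorphism.Build free_tensor V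
  free_tensor_lift free_tensor_lift_zmod_morphism.

Lemma free_tensor_liftE a m : free_tensor_lift (free_tens a m) = f a m.
Proof. by rewrite /free_tensor_lift liftU scale1r. Qed.

Lemma free_tensor_lift_rel t : t \in tensor_rel -> free_tensor_lift t = 0.
Proof.
move=> /asboolP /(_ [pred u | free_tensor_lift u == 0]) tK; apply/eqP/tK.
  split=> [|u v]; rewrite !inE ?raddf0 // => /eqP u0 /eqP v0.
  by rewrite raddfB /= u0 v0 subr0.
move=> u [a b m|a m n|a r m]; rewrite inE raddfB subr_eq0 /=.
- by rewrite raddfD /= !free_tensor_liftE fDl.
- by rewrite raddfD /= !free_tensor_liftE fDr.
- by rewrite !free_tensor_liftE fM.
Qed.

Definition tensor_lift (t : tensor) : V :=
  free_tensor_lift (repr (t : Quotient.quot (tensor_rel : zmodClosed _))).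

Lemma tensor_lift_pi t : tensor_lift (tensor_pi t) = free_tensor_lift t.
Proof.
apply/eqP; rewrite -subr_eq0 -raddfB; apply/eqP/free_tensor_lift_rel.
by apply/tensor_piP; rewrite /tensor_pi reprK.
Qed.

Lemma tensor_lift_tens a m : tensor_lift (tens a m) = f a m.
Proof. by rewrite tensor_lift_pi free_tensor_liftE. Qed.

Lemma tensor_lift_zmod_morphism : zmod_morphism tensor_lift.
Proof.
move=> t u.
have E v : v = tensor_pi (repr (v : Quotient.quot (tensor_rel : zmodClosed _))).
  by rewrite /tensor_pi reprK.
by rewrite (E t) (E u) -raddfB !tensor_lift_pi raddfB.
Qed.

End Lift.
End Tensor.

(* 1 (x) g : A (x)_R M -> A (x)_R N                                           *)
Section TensorMap.
Variables (R : pzRingType) (A : lmodType R^c) (M N : lmodType R).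
Variable g : {linear M -> N}.

Definition tensor_map : tensor A M -> tensor A N :=
  tensor_lift (fun (a : A) m => tens a (g m)).

Let DL (a b : A) m : tens (a + b) (g m) = tens a (g m) + tens b (g m).
Proof. exact: tensDl. Qed.
Let DR (a : A) m n : tens a (g (m + n)) = tens a (g m) + tens a (g n).
Proof. by rewrite raddfD tensDr. Qed.
Let BM (a : A) (r : R) m : tens ((r : R^c) *: a) (g m) = tens a (g (r *: m)).
Proof. by rewrite linearZ tensM. Qed.

Lemma tensor_map_zmod_morphism : zmod_morphism tensor_map.
Proof. exact: tensor_lift_zmod_morphism DL DR BM. Qed.

HB.instance Definition _ := GRing.isZmodMorphism.Build (tensor A M) (tensor A N)
  tensor_map tensor_map_zmod_morphism.

Lemma tensor_map_tens a m : tensor_map (tens a m) = tens a (g m).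
Proof. exact: (tensor_lift_tens DL DR BM). Qed.

End TensorMap.

Arguments tensor_map {R} A {M N} g _.

(* A (x)_R R is a right module: (a (x) x) r = a (x) x r.                      *)
Section TensorRegular.
Variables (R : pzRingType) (A : lmodType R^c).

Definition tensreg_scale (r : R^c) (t : tensor A R^o) : tensor A R^o :=
  tensor_map A (rmul (r : R)) t.

Lemma tensreg_scaleA r s t :
  tensreg_scale r (tensreg_scale s t) = tensreg_scale (r * s) t.
Proof.
rewrite /tensreg_scale; elim/tensor_ind: t => [a x|t u]; last first.
  by move=> et eu; rewrite !raddfB /= et eu.
by rewrite !tensor_map_tens /= /rmul -mulrA.
Qed.

Lemma tensreg_scale1 : left_id 1 tensreg_scale.
Proof.
rewrite /tensreg_scale; elim/tensor_ind => [a x|t u]; last first.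
  by move=> et eu; rewrite !raddfB /= et eu.
by rewrite tensor_map_tens /= /rmul mulr1.
Qed.

Lemma tensreg_scaleDr : right_distributive tensreg_scale +%R.
Proof. by move=> r t u; rewrite /tensreg_scale raddfD. Qed.

Lemma tensreg_scaleDl t : {morph tensreg_scale^~ t : r s / r + s}.
Proof.
move=> r s; rewrite /tensreg_scale; elim/tensor_ind: t => [a x|t u]; last first.
  by move=> et eu; rewrite !raddfB /= et eu opprD addrACA.
by rewrite !tensor_map_tens /= /rmul mulrDr tensDr.
Qed.

HB.instance Definition _ := GRing.Zmodule_isLmodule.Build R^c (tensor A R^o)
  tensreg_scaleA tensreg_scale1 tensreg_scaleDr tensreg_scaleDl.

End TensorRegular.

Definition injective_module (R : pzRingType) (I : lmodType R) :=
  forall (M N : lmodType R) (i : {linear M -> N}) (f : {linear M -> I}),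
    injective i -> exists g : {linear N -> I}, forall x, g (i x) = f x.

(* Every nonzero submodule of N meets the image of i nontrivially.            *)
Definition essential (R : pzRingType) (M N : lmodType R) (i : {linear M -> N}) :=
  forall S : {pred N}, submod_closed S -> (exists2 y, y \in S & y != 0) ->
    exists2 x, i x \in S & i x != 0.

Record injective_envelope (R : pzRingType) (M : lmodType R) := InjectiveEnvelope {
  envelope :> lmodType R;
  envelope_map : {linear M -> envelope};
  envelope_map_inj : injective envelope_map;
  envelope_map_essential : essential envelope_map;
  envelope_injective : injective_module envelope
}.

(* Although the envelope I of R is only a left module, each right             *)
(* multiplication of R extends to I. This makes ker (1 (x) iota) and          *)
(* im Hom(iota, C) submodules and not merely subgroups.                       *)
Lemma envelope_rmul (R : pzRingType) (E : injective_envelope R^o) (r : R) :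
  exists h : {linear E -> E},
    forall x, h (envelope_map E x) = envelope_map E (rmul r x).
Proof.
have [h hE] := @envelope_injective _ _ E _ _ (envelope_map E)
  (envelope_map E \o rmul r) (@envelope_map_inj _ _ E).
by exists h.
Qed.

Section Torsion.
Variables (R : pzRingType) (E : injective_envelope R^o) (A : lmodType R^c).

Definition torsion_pred : {pred tensor A R^o} :=
  fun t => tensor_map A (envelope_map E) t == 0.

Lemma torsion_submod_closed : submod_closed torsion_pred.
Proof.
split=> [|r t u]; rewrite !unfold_in ?raddf0 // => /eqP t0 /eqP u0.
have [h hE] := envelope_rmul E r.
rewrite raddfD /= u0 addr0.
suff -> : tensor_map A (envelope_map E) (r *: t) =
          tensor_map A h (tensor_map A (envelope_map E) t) by rewrite t0 raddf0.
elim/tensor_ind: t {t0} => [a x|t v]; last first.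
  by move=> et eu; rewrite scalerBr !raddfB /= et eu.
by rewrite /GRing.scale /= /tensreg_scale !tensor_map_tens hE.
Qed.

HB.instance Definition _ := GRing.isSubmodClosed.Build R^c (tensor A R^o)
  torsion_pred torsion_submod_closed.

(* s(A) = ker (1 (x) iota : A (x)_R R -> A (x)_R I)                           *)
Record torsion := Torsion {
  torsion_val :> tensor A R^o;
  torsion_valP : torsion_val \in torsion_pred
}.

HB.instance Definition _ := [isSub for torsion_val].
HB.instance Definition _ := [Choice of torsion by <:].
HB.instance Definition _ := [SubChoice_isSubLmodule of torsion by <:].

End Torsion.

Section Cotorsion.
Variables (R : pzRingType) (E : injective_envelope R^o) (C : lmodType R).

Definition hom_restrict (f : hom E C) : hom R^o C := f \o envelope_map E.

Definition cotorsion_pred : {pred hom R^o C} :=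
  fun f => `[< exists g : hom E C, f = hom_restrict g >].

Lemma cotorsion_submod_closed : submod_closed cotorsion_pred.
Proof.
split=> [|r f1 f2].
  by apply/asboolP; exists 0; apply: linear_ext.
move=> /asboolP [g1 ->] /asboolP [g2 ->]; apply/asboolP.
have [h hE] := envelope_rmul E r.
exists ((g1 \o h : hom E C) + g2); apply: linear_ext => x /=.
by rewrite hE.
Qed.

HB.instance Definition _ := GRing.isSubmodClosed.Build R (hom R^o C)
  cotorsion_pred cotorsion_submod_closed.

(* q(C) = coker (Hom(iota, C) : Hom_R(I, C) -> Hom_R(R, C))                   *)
Definition cotorsion : lmodType R :=
  quotmod (cotorsion_pred : submodClosed (hom R^o C)).

End Cotorsion.

(* Main.v *)
(* The adjunction Hom_R(M, A^+) = (A (x)_R M)^+ is natural in M. Taken at     *)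
(* M = R, followed by restriction to s(A), it gives Hom_R(R, A^+) -> s(A)^+,  *)
(* which is onto because Q/Z is an injective abelian group. A map lies in the *)
(* kernel iff its adjoint A (x) R -> Q/Z kills s(A) = ker (1 (x) iota), iff   *)
(* (again by injectivity of Q/Z) the adjoint extends along 1 (x) iota to      *)
(* A (x) I -> Q/Z, iff the map itself factors through iota.                   *)
Require Import Defs.
From HB Require Import structures.
From mathcomp Require Import all_boot all_order all_algebra.
From mathcomp Require Import generic_quotient ring_quotient.
From mathcomp Require Import boolp classical_sets.

Set Implicit Arguments.
Unset Strict Implicit.
Unset Printing Implicit Defensive.

(* [hom] is shadowed by mathcomp's [vector.hom] until Defs is imported again. *)
Import Defs GRing.Theory Num.Theory.
Local Open Scope ring_scope.
Local Open Scope quotient_scope.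

(** Sending f : R -> A^+ to its adjoint A (x) R -> Q/Z, restricted to s(A), is R-linear; it is shown
    to be onto s(A)^+ with kernel the maps that factor through iota, and [quotmod_iso] concludes.
    Both facts rest on [divisible_extension]: a homomorphism into a divisible group extends along
    any i whose kernel it kills. It is applied along the inclusion of s(A) in [torsion_char_surj]
    and along 1 (x) iota in [torsion_char_ker]; [tensor_eval_surj] turns the extended characters
    back into R-linear maps into A^+. *)

Definition divisible (V : zmodType) :=
  forall (v : V) (n : nat), exists w : V, w *+ n.+1 = v.

Lemma divisible_QZ : divisible QZ.
Proof.
move=> v n; elim/quotW: v => q.
exists (\pi_QZ (q / n.+1%:R)); rewrite -raddfMn /= -[_ *+ n.+1]mulr_natr.
by rewrite divfK // pnatr_eq0.
Qed.

Section DivisibleExtension.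
Variables (S U V : zmodType) (i : {additive S -> U}) (f : {additive S -> V}).
Hypotheses (divV : divisible V) (f_ker : forall s, i s = 0 -> f s = 0).

(** Partial homomorphisms are encoded by their graphs: subgroups of U * V containing all (i s, f s).
    For a subgroup, being single-valued at 0 means being single-valued everywhere. *)
Let partial_hom (G : set (U * V)) :=
  [/\ forall s, G (i s, f s), forall p q, G p -> G q -> G (p - q) &
      forall v, G (0, v) -> v = 0].

Let partial_homMz G u v (n : int) :
  partial_hom G -> G (u, v) -> G (u *~ n, v *~ n).
Proof.
move=> [G0 GB _] Guv.
have Gz : G (0, 0) by have := GB _ _ (G0 0) (G0 0); rewrite subrr.
have GN x y : G (x, y) -> G (- x, - y).
  by move=> /(GB _ _ Gz); rewrite -[_ - _]/(0 - x, 0 - y) !sub0r.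
have GMn k : G (u *+ k, v *+ k).
  elim: k => [//|k /GN IHk]; rewrite !mulrS -[u *+ k]opprK -[v *+ k]opprK.
  exact: GB Guv IHk.
by case: n => n; [exact: GMn | exact/GN/GMn].
Qed.

(* The multiples n with u n in the domain of G form an ideal of Z; dividing   *)
(* the value of G at its generator yields a value at u compatible with G.     *)
Let partial_hom_value G (u : U) : partial_hom G ->
  exists w : V, forall (n : int) v, G (u *~ n, v) -> v = w *~ n.
Proof.
move=> Gh; have [G0 GB Gf] := Gh.
(* The index n stands for the positive multiple n + 1. *)
pose D (n : nat) := `[< exists v, G (u *+ n.+1, v) >].
have [[n0 Dn0]|noD] := pselect (exists n, D n); last first.
  have noP n v : ~ G (u *+ n.+1, v).
    by move=> Gn; apply: noD; exists n; apply/asboolP; exists v.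
  (* No nonzero multiple of u is in the domain, so any value would do. *)
  exists 0 => -[[|n]|n] v Gn.
  - by rewrite mul0rz; apply: Gf; rewrite mulr0z in Gn.
  - by case: (noP n v).
  - case: (noP n (- v)); have := partial_homMz (-1) Gh Gn.
    by rewrite NegzE !mulrNz !mulr1z opprK.
have exD : exists n, D n by exists n0.
case: (ex_minnP exD) => d /asboolP [v0 Gd] dmin.
have [w wE] := divV v0 d; exists w => n v Gn.
(* Subtracting a multiple of (u, w) (d + 1) puts the remainder in the domain; minimality of d then
   makes it 0. *)
have Gr : G (u *~ (n %% d.+1)%Z, v - w *~ ((n %/ d.+1)%Z * d.+1)).
  have mulE (M : zmodType) (x : M) (q : int) : x *~ (q * d.+1) = x *+ d.+1 *~ q.
    by rewrite -mulrzA_C.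
  have := GB _ _ Gn (partial_homMz (n %/ d.+1)%Z Gh Gd).
  by rewrite -wE -!mulE -[_ - _]/(_ - _, _ - _) -mulrzBr.
have r0 : (n %% d.+1)%Z = 0.
  have := modz_ge0 n (isT : d.+1%:Z != 0).
  have := ltz_pmod n (isT : 0 < d.+1%:Z).
  case: (n %% d.+1)%Z Gr => [[|k]|k] //= Gk kd _.
  have := dmin k; rewrite leqNgt; move: kd; rewrite ltz_nat ltnS => -> /=.
  by move=> /(_ (asboolT (ex_intro _ _ Gk))).
move: Gr; rewrite r0 mulr0z => /Gf /eqP; rewrite subr_eq0 => /eqP ->.
by rewrite {2}(divz_eq n d.+1) r0 addr0.
Qed.

Let partial_hom_max :
  exists2 G, partial_hom G &
    forall H, partial_hom H -> (G `<=` H -> H `<=` G)%classic.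
Proof.
pose G0 : set (U * V) := [set p | exists s, p = (i s, f s)]%classic.
have G0h : partial_hom G0.
  split=> [s|_ _ [s ->] [t ->]|v [s [/esym is0 ->]]]; last exact: f_ker.
    by exists s.
  by exists (s - t); rewrite !raddfB.
(* Zorn is applied to the sets X with G0 [|] X a partial homomorphism, so that the empty chain,
   whose union is empty, also has an admissible bound. *)
have [|G [Gh Gmax]] := @Zorn_bigcup _ (fun X => partial_hom (G0 `|` X)%classic).
  move=> F FP Ftot.
  set W := (\bigcup_(X in F) X)%classic.
  have sub X : F X -> (G0 `|` X `<=` G0 `|` W)%classic.
    by move=> FX; apply: setUS; exact: bigcup_sup.
  split=> [s|p q [Gp|[X FX Xp]] [Gq|[Y FY Yq]]|v [Gv|[X FX Xv]]].
  - by left; exists s.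
  - by left; case: G0h => _ + _; apply.
  - by apply: (sub Y FY); case: (FP _ FY) => _ + _; apply; [left|right].
  - by apply: (sub X FX); case: (FP _ FX) => _ + _; apply; [right|left].
  - have [XY|YX] := Ftot _ _ FX FY.
    + apply: (sub Y FY); case: (FP _ FY) => _ + _; apply; right => //.
      exact: XY.
    + apply: (sub X FX); case: (FP _ FX) => _ + _; apply; right => //.
      exact: YX.
  - by case: G0h => _ _; apply.
  - by case: (FP _ FX) => _ _; apply; right.
exists (G0 `|` G)%classic => // H Hh GH p Hp; apply: contrapT => nGp.
apply: (Gmax H).
  split; first by apply: subset_trans GH; exact: subsetUr.
  by move=> /(_ p Hp) Gp; apply: nGp; right.
suff -> : (G0 `|` H = H)%classic by [].
by apply/setUidPr => _ [s ->]; case: Hh.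
Qed.

Lemma divisible_extension :
  exists g : {additive U -> V}, forall s, g (i s) = f s.
Proof.
have [G Gh Gmax] := partial_hom_max.
have [G0 GB Gf] := Gh.
have Gz : G 0 by rewrite -(subrr (i 0, f 0)); exact: GB.
have dom u : exists v, G (u, v).
  have [w wE] := partial_hom_value u Gh.
  (* H is the subgroup generated by G and (u, w); compatibility of w keeps it single-valued, so
     maximality puts (u, w) in G. *)
  pose H : set (U * V) :=
    [set p | exists n : int, G (p.1 - u *~ n, p.2 - w *~ n)]%classic.
  have subzM (M : zmodType) (x a b : M) (m n : int) :
      (a - b) - x *~ (m - n) = (a - x *~ m) - (b - x *~ n).
    by rewrite mulrzBr !opprB addrACA [- _ + _ in LHS]addrC addrACA.
  exists w; apply: (Gmax H); last by exists 1; rewrite /= !mulr1z !subrr.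
    split=> [s|p q [m Gm] [n Gn]|v [n]] /=.
    - by exists 0; rewrite !mulr0z !subr0; exact: G0.
    - by exists (m - n); rewrite /= !subzM; exact: GB Gm Gn.
    - rewrite sub0r -mulrNz => /wE /eqP.
      by rewrite subr_eq -mulrzDr addNr mulr0z => /eqP.
  by move=> [x y] Gxy; exists 0; rewrite /= !mulr0z !subr0.
have [g gE] := choice dom.
have gP u v : G (u, v) -> g u = v.
  by move=> Guv; apply/eqP; rewrite -subr_eq0; apply/eqP/Gf;
     rewrite -(subrr u); exact: GB (gE u) Guv.
have gB : zmod_morphism g by move=> u v; apply: gP; exact: GB (gE u) (gE v).
pose ga := GRing.isZmodMorphism.Build _ _ g gB.
exists (HB.pack_for {additive U -> V} g ga) => s; exact: gP.
Qed.

End DivisibleExtension.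

Section TensorHom.
Variables (R : pzRingType) (A : lmodType R^c) (M : lmodType R).

Definition tensor_eval (f : hom M (character A)) : tensor A M -> QZ :=
  tensor_lift (fun a m => f m a).

Let evalDl (f : hom M (character A)) a b m : f m (a + b) = f m a + f m b.
Proof. exact: raddfD. Qed.
Let evalDr (f : hom M (character A)) a m n : f (m + n) a = f m a + f n a.
Proof. by rewrite raddfD. Qed.
Let evalM (f : hom M (character A)) a (r : R) m :
  f m ((r : R^c) *: a) = f (r *: m) a.
Proof. by rewrite linearZ. Qed.

Lemma tensor_eval_zmod_morphism f : zmod_morphism (tensor_eval f).
Proof. exact: tensor_lift_zmod_morphism (evalDl f) (evalDr f) (evalM f). Qed.

HB.instance Definition _ f := GRing.isZmodMorphism.Build (tensor A M) QZ
  (tensor_eval f) (tensor_eval_zmod_morphism f).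

Lemma tensor_eval_tens f a m : tensor_eval f (tens a m) = f m a.
Proof. exact: (tensor_lift_tens (evalDl f) (evalDr f) (evalM f)). Qed.

(** The preimage is m |-> (a |-> g (a (x) m)), whose R-linearity is the balancing relation. *)
Lemma tensor_eval_surj (g : {additive tensor A M -> QZ}) :
  exists f, tensor_eval f =1 g.
Proof.
have gB m : zmod_morphism (fun a => g (tens a m)).
  by move=> a b; rewrite -raddfB; congr (g _); apply: (addIr (tens b m));
     rewrite -tensDl !subrK.
pose c m : character A :=
  HB.pack_for {additive A -> QZ} (fun a => g (tens a m))
    (GRing.isZmodMorphism.Build _ _ _ (gB m)).
have cL : linear c.
  move=> r m n; apply: additive_ext => a /=.
  by rewrite tensDr raddfD /= -tensM.
exists (HB.pack_for {linear M -> character A} c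
          (GRing.isLinear.Build _ _ _ _ _ cL)).
by apply: tensor_ext => a m /=; rewrite tensor_eval_tens.
Qed.

End TensorHom.

(** The actions on Hom(R, A^+) and on A (x) R both come from right multiplication on R, so the
    adjunction matches them; this makes [torsion_char] R-linear. *)
Lemma tensor_eval_linear (R : pzRingType) (A : lmodType R^c) (r : R)
    (f g : hom R^o (character A)) (t : tensor A R^o) :
  tensor_eval (r *: f + g) t = tensor_eval f ((r : R^c) *: t) + tensor_eval g t.
Proof.
elim/tensor_ind: t => [a x|t u et eu].
  by rewrite [_ *: _ in RHS]tensor_map_tens !tensor_eval_tens.
by rewrite scalerBr !raddfB /= et eu opprD addrACA.
Qed.

(** First isomorphism theorem, from N to M/K: a chosen section of p becomes linear modulo K, since
    two elements agree modulo K iff p identifies them. *)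
Lemma quotmod_iso (R : pzRingType) (M N : lmodType R) (K : submodClosed M)
    (p : {linear M -> N}) :
  (forall y, exists x, p x = y) -> (forall x, x \in K <-> p x = 0) ->
  exists f : {linear N -> quotmod K}, bijective f.
Proof.
move=> /choice [s sK] Kp.
have pi_eq x y : quotmod_pi K x = quotmod_pi K y <-> p x = p y.
  rewrite quotmod_piP Kp raddfB.
  by split=> /eqP; [rewrite subr_eq0 | rewrite -subr_eq0] => /eqP.
have sL : linear (quotmod_pi K \o s).
  by move=> r x y /=; rewrite -linearP; apply/pi_eq; rewrite linearP !sK.
exists (HB.pack_for {linear N -> quotmod K} (quotmod_pi K \o s)
          (GRing.isLinear.Build _ _ _ _ _ sL)).
have [t tK] := choice (@quotmod_pi_surj _ _ K).
exists (p \o t) => [y|q] /=.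
  by rewrite -[RHS]sK; apply/pi_eq; rewrite -tK.
by rewrite [RHS]tK; apply/pi_eq; rewrite sK.
Qed.

Section TorsionCharacter.
Variables (R : pzRingType) (E : injective_envelope R^o) (A : lmodType R^c).

Definition torsion_char (f : hom R^o (character A)) : character (torsion E A) :=
  (tensor_eval f : {additive _ -> _}) \o (val : {additive torsion E A -> _}).

Lemma torsion_char_linear : linear torsion_char.
Proof.
move=> r f g; apply: additive_ext => t /=.
exact: tensor_eval_linear.
Qed.

HB.instance Definition _ := GRing.isLinear.Build R (hom R^o (character A))
  (character (torsion E A)) *:%R torsion_char torsion_char_linear.

Lemma torsion_char_surj (c : character (torsion E A)) :
  exists f, torsion_char f = c.
Proof.
have [|g gE] := @divisible_extension _ _ _
  (val : {additive torsion E A -> tensor A R^o}) c divisible_QZ.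
  move=> t t0; have -> : t = 0 by apply: val_inj.
  exact: raddf0.
have [f fE] := tensor_eval_surj g.
by exists f; apply: additive_ext => t; rewrite /= fE gE.
Qed.

Lemma torsion_char_ker f :
  f \in cotorsion_pred E (C := character A) <-> torsion_char f = 0.
Proof.
split=> [/asboolP [g ->]|f0].
  apply: additive_ext => t /=.
  (* Naturality of the adjunction along iota. *)
  have -> : tensor_eval (hom_restrict g) =1
            tensor_eval g \o tensor_map A (envelope_map E).
    apply: (tensor_ext (g := _ \o _)) => a x.
    by rewrite /= tensor_map_tens !tensor_eval_tens.
  by have /eqP /= -> := torsion_valP t; rewrite raddf0.
(* The map 1 (x) iota may fail to be injective, but [f0] says exactly that the adjoint of f kills
   its kernel s(A). *)
have [|h hE] := @divisible_extension _ _ _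
  (tensor_map A (envelope_map E) : {additive _ -> _})
  (tensor_eval f : {additive _ -> _}) divisible_QZ.
  move=> t /eqP t0; have := congr1 (fun c : character _ => c (Torsion t0)) f0.
  by [].
have [g gE] := tensor_eval_surj h.
apply/asboolP; exists g; apply: linear_ext => x; apply: additive_ext => a /=.
by rewrite -!tensor_eval_tens gE -hE /= tensor_map_tens.
Qed.

End TorsionCharacter.

Theorem corollary4p10 (R : pzRingType) (E : injective_envelope R^o)
    (A : lmodType R^c) :
  exists f : {linear character (torsion E A) -> cotorsion E (character A)},
    bijective f.
Proof.
exact: quotmod_iso (@torsion_char_surj R E A) (@torsion_char_ker R E A).
Qed.
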